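(* Let $H\in\mathbb{N}$, $\alpha\in\mathbb{R}$, and let $\mathcal{L}_\infty$, $\mathcal{G}$, $V$, $\|\cdot\|$ be as in the context. Let $\Theta\in C([0,\infty),\mathbb{R}^{3H+1})$ satisfy for all $t\in[0,\infty)$ that $\Theta_t=\Theta_0-\int_0^t\mathcal{G}(\Theta_s)\,ds$. Then (i) $\sup_{t\in[0,\infty)}\|\Theta_t\|\le[V(\Theta_0)]^{1/2}<\infty$; (ii) for all $t\in(0,\infty)$ it holds that $\mathcal{L}_\infty(\Theta_t)\le\dfrac{V(\Theta_0)}{8t}$; and (iii) $\limsup_{t\to\infty}\mathcal{L}_\infty(\Theta_t)=0$.
   Context: $\mathbb{N}=\{1,2,\dots\}$. Fix $H\in\mathbb{N}$, $\alpha\in\mathbb{R}$. For $r\in[1,\infty)$, $x\in\mathbb{R}$ let $\sigma_r(x)=r^{-1}\ln(1+r^{-1}e^{rx})$, and let $\sigma_\infty(x)=\max\{x,0\}$. For $r\in[1,\infty]$, $\phi=(\phi_1,\dots,\phi_{3H+1})\in\mathbb{R}^{3H+1}$, $x\in\mathbb{R}$ let $\mathscr{N}_r^{\phi}(x)=\phi_{3H+1}+\sum_{j=1}^{H}\phi_{2H+j}\,\sigma_r(\phi_jx+\phi_{H+j})$ and $\mathcal{L}_r(\phi)=\int_0^1(\mathscr{N}_r^{\phi}(y)-\alpha)^2\,dy$. The function $\mathcal{G}\colon\mathbb{R}^{3H+1}\to\mathbb{R}^{3H+1}$ satisfies $\mathcal{G}(\phi)=\lim_{r\to\infty}(\nabla\mathcal{L}_r)(\phi)$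 for every $\phi$ for which the sequence $((\nabla\mathcal{L}_r)(\phi))_{r\in\mathbb{N}}$ converges. $\|\cdot\|$ is the Euclidean norm. $V\colon\mathbb{R}^{3H+1}\to\mathbb{R}$ is given by $V(\phi)=\|\phi\|^2+(\phi_{3H+1}-2\alpha)^2$. *)

(* Defs.v *)
From mathcomp Require Import all_boot all_order all_algebra.
From mathcomp Require Import all_classical all_reals all_analysis.

Set Implicit Arguments.
Unset Strict Implicit.
Unset Printing Implicit Defensive.

Import Order.TTheory GRing.Theory Num.Theory.
Import numFieldNormedType.Exports.

Local Open Scope classical_set_scope.
Local Open Scope ring_scope.

(* The parameter space R^(3H+1).  Its library topology comes from the sup norm,
   which is equivalent to the Euclidean norm [enorm] below. *)
Notation param R H := ('rV[R]_(3 * H).+1) (only parsing).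

(* [coord phi k] is phi_k with the 1-based numbering phi_1, ..., phi_(3H+1);
   it is meant for 1 <= k <= 3H+1 only. *)
Definition coord (R : realType) (H : nat) (phi : param R H) (k : nat) : R :=
  phi ord0 (inord k.-1).

(* Meant for r in [1, +oo]; the value at -oo is irrelevant. *)
Definition sigma (R : realType) (r : \bar R) (x : R) : R :=
  match r with
  | s%:E => s^-1 * ln (1 + s^-1 * expR (s * x))
  | +oo%E => Num.max x 0
  | -oo%E => 0
  end.

Definition net (R : realType) (H : nat) (r : \bar R) (phi : param R H)
    (x : R) : R :=
  coord phi (3 * H + 1) +
  \sum_(1 <= j < H.+1)
    coord phi (2 * H + j) * sigma r (coord phi j * x + coord phi (H + j)).

Definition risk (R : realType) (H : nat) (alpha : R) (r : \bar R)
    (phi : param R H) : R :=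
  \int[lebesgue_measure]_(y in `[0, 1]) (net r phi y - alpha) ^+ 2.

Definition grad (R : realType) (n : nat) (f : 'rV[R]_n.+1 -> R)
    (x : 'rV[R]_n.+1) : 'rV[R]_n.+1 :=
  \row_i 'D_(delta_mx ord0 i) f x.

Definition enorm (R : realType) (n : nat) (x : 'rV[R]_n) : R :=
  Num.sqrt (\sum_i x ord0 i ^+ 2).

Definition lyapunov (R : realType) (H : nat) (alpha : R)
    (phi : param R H) : R :=
  enorm phi ^+ 2 + (coord phi (3 * H + 1) - 2 * alpha) ^+ 2.

(* Only r = 1, 2, ... occur in the sequence of gradients, hence the shift.
   G is left unconstrained where that sequence diverges. *)
Definition is_generalized_gradient (R : realType) (H : nat) (alpha : R)
    (G : param R H -> param R H) : Prop :=
  forall phi : param R H,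
    let u := fun n : nat => grad (risk alpha (n.+1%:R)%:E) phi in
    cvgn u -> G phi = limn u.

(* Coordinatewise Lebesgue integral over [a, b]. *)
Definition row_integral (R : realType) (n : nat) (a b : R)
    (f : R -> 'rV[R]_n) : 'rV[R]_n :=
  \row_i \int[lebesgue_measure]_(s in `[a, b]) f s ord0 i.

(* Main.v *)
(** The derivatives of the smooth activations converge to the indicator of (0, oo), so
    by dominated convergence the gradients of the smooth risks converge everywhere
    and G is the explicit field [drisk alpha +oo], the integral over y of
    2 (N(y) - alpha) times the formal gradient of N.  Since the network is
    homogeneous of degree two apart from its output bias, this field satisfies
    <grad V, G> = 8 L_oo.

    A function f with Lipschitz gradient obeys
    f(Theta_b) - f(Theta_a) = - int_a^b <grad f(Theta_s), G(Theta_s)> ds although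
    Theta is only Lipschitz: the difference of the two sides has increments of
    size O((t - s)^2), hence is constant.  For f = V this gives
    V(Theta_t) = V(Theta_0) - 8 int_0^t L_oo(Theta_s) ds, and for the smooth risks,
    letting r -> oo, it shows that L_oo(Theta_t) is nonincreasing.  Therefore
    8 t L_oo(Theta_t) <= V(Theta_0). *)

Require Import Defs.
From mathcomp Require Import all_boot all_order all_algebra.
From mathcomp Require Import all_classical all_reals all_analysis.
From mathcomp Require Import measurable_realfun zify ring lra.

Set Implicit Arguments.
Unset Strict Implicit.
Unset Printing Implicit Defensive.

Import Order.TTheory GRing.Theory Num.Theory.
Import numFieldNormedType.Exports.

Local Open Scope classical_set_scope.
Local Open Scope ring_scope.

(** * Integrals of bounded measurable functions *)

Section bounded_measurable.
Context {R : realType}.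
Local Notation mu := (@lebesgue_measure R).
Implicit Types (a b C : R) (f g : R -> R).

(** A class closed under products and bounded pointwise limits, which mere integrability is not.
    Continuity would be too strong, since the limit field jumps with the indicator of (0, oo). *)
Definition bmeas a b f : Prop :=
  measurable_fun `[a, b] f /\
  exists C, forall x, x \in `[a, b]%R -> `|f x| <= C.

Lemma bmeas_integrable a b f :
  bmeas a b f -> mu.-integrable `[a, b] (EFin \o f).
Proof.
move=> [mf [C fC]]; apply: measurable_bounded_integrable => //.
  by rewrite /= lebesgue_measure_itv/=; case: ifP => // _; rewrite -EFinB ltry.
exists C; split; first exact: num_real.
by move=> M CM x /= xab; apply: le_trans (ltW CM); exact: fC.
Qed.

Lemma bmeas_sub a b c d f : a <= c -> d <= b -> bmeas a b f -> bmeas c d f.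
Proof.
move=> ac db [mf [C fC]].
have cdab : `[c, d]%classic `<=` `[a, b]%classic.
  by move=> x /=; rewrite !in_itv/= => /andP[cx xd]; apply/andP; split;
    [exact: le_trans cx|exact: le_trans db].
split; first by apply: measurable_funS mf.
by exists C => x /cdab; exact: fC.
Qed.

Lemma bmeas_cst a b C : bmeas a b (fun=> C).
Proof. by split; [exact: measurable_cst|exists `|C|]. Qed.

Lemma bmeasD {a b f g} :
  bmeas a b f -> bmeas a b g -> bmeas a b (fun x => f x + g x).
Proof.
move=> [mf [C fC]] [mg [D gD]]; split; first exact: measurable_funD.
exists (C + D) => x xab; apply: le_trans (ler_normD _ _) _.
by apply: lerD; [exact: fC|exact: gD].
Qed.

Lemma bmeasM {a b f g} :
  bmeas a b f -> bmeas a b g -> bmeas a b (fun x => f x * g x).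
Proof.
move=> [mf [C fC]] [mg [D gD]]; split; first exact: measurable_funM.
by exists (C * D) => x xab; rewrite normrM ler_pM// ?fC ?gD.
Qed.

Lemma bmeas_sum (I : Type) (s : seq I) a b (F : I -> R -> R) :
  (forall i, bmeas a b (F i)) -> bmeas a b (fun x => \sum_(i <- s) F i x).
Proof.
move=> bF; elim: s => [|i s IH].
  by under eq_fun do rewrite big_nil; exact: bmeas_cst.
by under eq_fun do rewrite big_cons; exact: bmeasD.
Qed.

Lemma bmeas_continuous a b f : {within `[a, b], continuous f} -> bmeas a b f.
Proof.
move=> cf; split.
  by apply: subspace_continuous_measurable_fun => //; exact: measurable_itv.
have [ab|ba] := leP a b.
  have cnf : {within `[a, b], continuous (fun x => `|f x|)}.
    by move=> x; apply: (continuous_comp (cf x)); exact: norm_continuous.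
  have [c _ cmax] := EVT_max ab cnf.
  by exists `|f c| => x; exact: cmax.
by exists 0 => x; rewrite in_itv/= => /andP[ax /(le_trans ax)]; rewrite leNgt ba.
Qed.

Lemma RintegralZ_bmeas a b C f : bmeas a b f ->
  \int[mu]_(x in `[a, b]) (C * f x) = C * \int[mu]_(x in `[a, b]) f x.
Proof. by move=> /bmeas_integrable fi; rewrite RintegralZl. Qed.

Lemma RintegralD_bmeas a b f g : bmeas a b f -> bmeas a b g ->
  \int[mu]_(x in `[a, b]) (f x + g x) =
  \int[mu]_(x in `[a, b]) f x + \int[mu]_(x in `[a, b]) g x.
Proof. by move=> /bmeas_integrable fi /bmeas_integrable gi; rewrite RintegralD. Qed.

Lemma RintegralB_bmeas a b f g : bmeas a b f -> bmeas a b g ->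
  \int[mu]_(x in `[a, b]) (f x - g x) =
  \int[mu]_(x in `[a, b]) f x - \int[mu]_(x in `[a, b]) g x.
Proof. by move=> /bmeas_integrable fi /bmeas_integrable gi; rewrite RintegralB. Qed.

Lemma Rintegral_sum_bmeas (I : Type) (s : seq I) a b (F : I -> R -> R) :
  (forall i, bmeas a b (F i)) ->
  \int[mu]_(x in `[a, b]) (\sum_(i <- s) F i x) =
  \sum_(i <- s) \int[mu]_(x in `[a, b]) F i x.
Proof.
move=> bF; elim: s => [|i s IH].
  rewrite big_nil; under eq_Rintegral do rewrite big_nil.
  by rewrite Rintegral_cst// mul0r.
rewrite big_cons -IH -RintegralD_bmeas//; last exact: bmeas_sum.
by under eq_Rintegral do rewrite big_cons.
Qed.

Lemma Rintegral_cst_itv a b C : a <= b ->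
  \int[mu]_(x in `[a, b]) C = C * (b - a).
Proof.
move=> ab; rewrite Rintegral_cst//= lebesgue_measure_itv/=.
case: ifPn => //=; rewrite lte_fin -leNgt => ba.
by have -> : b = a; [apply/eqP; rewrite eq_le ba ab|rewrite subrr].
Qed.

Lemma normr_Rintegral_le a b C f : a <= b -> bmeas a b f ->
  (forall x, x \in `[a, b]%R -> `|f x| <= C) ->
  `|\int[mu]_(x in `[a, b]) f x| <= C * (b - a).
Proof.
move=> ab bf fC; rewrite -Rintegral_cst_itv//.
apply: le_trans (le_normr_Rintegral _ _) _ => //; first exact: bmeas_integrable.
apply: le_Rintegral => //.
- apply: bmeas_integrable; split; first by apply: measurableT_comp => //; case: bf.
  by case: bf => _ [D fD]; exists D => x /fD; rewrite normr_id.
- exact/bmeas_integrable/bmeas_cst.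
Qed.

Lemma ler_Rintegral_bmeas a b f g : bmeas a b f -> bmeas a b g ->
  (forall x, x \in `[a, b]%R -> f x <= g x) ->
  \int[mu]_(x in `[a, b]) f x <= \int[mu]_(x in `[a, b]) g x.
Proof.
by move=> /bmeas_integrable fi /bmeas_integrable gi fg; apply: le_Rintegral.
Qed.

Lemma RintegralB_itv a b c f : a <= b -> b <= c -> bmeas a c f ->
  \int[mu]_(x in `[a, c]) f x - \int[mu]_(x in `[a, b]) f x =
  \int[mu]_(x in `[b, c]) f x.
Proof.
move=> ab bc bf; rewrite Rintegral_itvB//.
- rewrite Rintegral_itv_obnd_cbnd//.
  have /bmeas_integrable : bmeas b c f by apply: bmeas_sub bf.
  by apply: integrableS => //; apply: subset_itvr; rewrite bnd_simp.
- exact: bmeas_integrable.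
Qed.

(** Supplies the measurability of every object at r = +oo from that of its smooth approximations. *)
Lemma bmeas_cvg a b C (f_ : nat -> R -> R) f :
  (forall n, measurable_fun `[a, b] (f_ n)) ->
  (forall n x, x \in `[a, b]%R -> `|f_ n x| <= C) ->
  (forall x, x \in `[a, b]%R -> f_ n x @[n --> \oo] --> f x) ->
  bmeas a b f.
Proof.
move=> mf fC ff; split; first exact: measurable_fun_cvg ff.
exists C => x xab.
have cf : `|f_ n x| @[n --> \oo] --> `|f x| by apply: cvg_norm; exact: ff.
rewrite -(cvg_lim _ cf)//; apply: limr_le; first exact: cvgP cf.
by apply: nearW => n; exact: fC.
Qed.

(** Dominated convergence, with a constant as dominating function on an interval of finite
    measure. *)
Lemma Rintegral_bounded_cvg a b C (f_ : nat -> R -> R) f :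
  (forall n, measurable_fun `[a, b] (f_ n)) ->
  (forall n x, x \in `[a, b]%R -> `|f_ n x| <= C) ->
  (forall x, x \in `[a, b]%R -> f_ n x @[n --> \oo] --> f x) ->
  \int[mu]_(x in `[a, b]) f_ n x @[n --> \oo] --> \int[mu]_(x in `[a, b]) f x.
Proof.
move=> mf fC ff; have [mf' _] := bmeas_cvg mf fC ff.
apply: fine_cvg => /=.
have [| | | | |_ _] := @dominated_convergence _ _ _ mu `[a, b]%classic
  (measurable_itv _) (fun n x => (f_ n x)%:E) (EFin \o f) (EFin \o fun=> C).
- by move=> n; apply/measurable_EFinP; exact: mf.
- exact/measurable_EFinP.
- by apply: aeW => x xab; apply: cvg_EFin; [exact: nearW|exact: ff].
- exact/bmeas_integrable/bmeas_cst.
- by apply: aeW => x n xab; rewrite lee_fin fC.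
rewrite fineK//; apply: integrable_fin_num => //.
exact: (bmeas_integrable (bmeas_cvg mf fC ff)).
Qed.

End bounded_measurable.

(** * Row vectors *)

Section row_vectors.
Context {R : realType}.

Lemma ler_coord_norm n (x : 'rV[R]_n) i : `|x ord0 i| <= `|x|.
Proof.
by rewrite [leRHS]/Num.Def.normr /= mx_normrE; apply/bigmax_geP; right => /=; exists (ord0, i).
Qed.

Lemma row_norm_le n (x : 'rV[R]_n) C :
  0 <= C -> (forall i, `|x ord0 i| <= C) -> `|x| <= C.
Proof.
move=> C0 xC; rewrite [leLHS]/Num.Def.normr /= mx_normrE; apply/bigmax_leP.
by split=> // -[i j] _ /=; rewrite ord1.
Qed.

Definition dot n (x y : 'rV[R]_n) : R := \sum_i x ord0 i * y ord0 i.

Lemma dotDl n (x y z : 'rV[R]_n) : dot (x + y) z = dot x z + dot y z.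
Proof. by rewrite -big_split; apply: eq_bigr => i _; rewrite mxE mulrDl. Qed.

Lemma dotZl n a (x y : 'rV[R]_n) : dot (a *: x) y = a * dot x y.
Proof. by rewrite mulr_sumr; apply: eq_bigr => i _; rewrite mxE mulrA. Qed.

Lemma dotC n (x y : 'rV[R]_n) : dot x y = dot y x.
Proof. by apply: eq_bigr => i _; rewrite mulrC. Qed.

Lemma dot0l n (x : 'rV[R]_n) : dot 0 x = 0.
Proof. by rewrite -(scale0r x) dotZl mul0r. Qed.

Lemma dotBl n (x y z : 'rV[R]_n) : dot (x - y) z = dot x z - dot y z.
Proof. by rewrite -scaleN1r dotDl dotZl mulN1r. Qed.

Lemma dot_suml n (I : Type) (s : seq I) (F : I -> 'rV[R]_n) y :
  dot (\sum_(i <- s) F i) y = \sum_(i <- s) dot (F i) y.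
Proof.
elim: s => [|i s IH]; first by rewrite !big_nil dot0l.
by rewrite !big_cons dotDl IH.
Qed.

Lemma dot_delta n i (x : 'rV[R]_n) : dot (delta_mx ord0 i) x = x ord0 i.
Proof.
rewrite /dot (bigD1 i)//= mxE !eqxx mul1r big1 ?addr0// => j ji.
by rewrite mxE (negbTE ji) andbF mul0r.
Qed.

(** Here [|x|] is the sup norm, hence the factor n in place of the Cauchy-Schwarz constant 1. *)
Lemma dot_norm_le n (x y : 'rV[R]_n) : `|dot x y| <= n%:R * `|x| * `|y|.
Proof.
apply: le_trans (ler_norm_sum _ _ _) _.
rewrite -mulrA mulr_natl -[leRHS](_ : \sum_(i < n) `|x| * `|y| = _).
  by apply: ler_sum => i _; rewrite normrM ler_pM// ler_coord_norm.
by rewrite sumr_const card_ord.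
Qed.

Lemma cvg_row n (u : nat -> 'rV[R]_n) (l : 'rV[R]_n) :
  (forall i, u k ord0 i @[k --> \oo] --> l ord0 i) -> u k @[k --> \oo] --> l.
Proof.
move=> ul; apply/cvgrPdist_le => e e0.
have : \forall k \near \oo, forall i, `|l ord0 i - u k ord0 i| <= e.
  apply: filter_forall => i.
  by move/cvgrPdist_le : (ul i) => /(_ _ e0).
apply: filterS => k uk; apply: row_norm_le; first exact: ltW.
by move=> i; rewrite !mxE.
Qed.

End row_vectors.

(** * The activation functions *)

Section softplus.
Context {R : realType}.
Implicit Types s x a b : R.

(* Derivative of [sigma r]; at r = +oo it is the pointwise limit, which is 0 at 0. *)
Definition dsigma (r : \bar R) (x : R) : R :=
  match r with
  | s%:E => expR (s * x) / (s + expR (s * x))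
  | +oo%E => (0 < x)%R%:R
  | -oo%E => 0
  end.

(** Euler's identity for the positively homogeneous ReLU; it drives the Lyapunov computation. *)
Lemma dsigma_oo_mul x : dsigma +oo%E x * x = sigma +oo%E x.
Proof.
by rewrite /dsigma /sigma; case: (ltP 0 x) => _; rewrite ?mul1r ?mul0r.
Qed.

Lemma is_derive_linear s x : is_derive x 1 (fun z : R => s * z) s.
Proof.
have -> : (fun z : R => s * z) = s *: (@id R) by [].
apply: is_derive_eq; by rewrite /GRing.scale /= mulr1.
Qed.

Lemma is_derive_expR_linear s x :
  is_derive x 1 (fun z : R => expR (s * z)) (s * expR (s * x)).
Proof.
rewrite mulrC; have := is_derive_linear s x.
exact: is_derive1_comp.
Qed.

Lemma is_derive_sigma s x : 0 < s ->
  is_derive x 1 (sigma s%:E) (dsigma s%:E x).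
Proof.
move=> s0; have e0 := expR_gt0 (s * x).
have d1 : is_derive x 1 (fun z : R => 1 + s^-1 * expR (s * z)) (expR (s * x)).
  have de := is_derive_expR_linear s x.
  have -> : (fun z : R => 1 + s^-1 * expR (s * z)) =
    cst 1 + s^-1 *: (fun z : R => expR (s * z)) by [].
  apply: (is_derive_eq (is_deriveD (is_derive_cst _ _ _) (is_deriveZ s^-1 de))).
  by rewrite add0r /GRing.scale /= mulrA mulVf ?mul1r// gt_eqF.
have p0 : 0 < 1 + s^-1 * expR (s * x).
  by rewrite addr_gt0// mulr_gt0// invr_gt0.
have d2 := is_derive1_comp (g := fun z : R => 1 + s^-1 * expR (s * z))
  (is_derive1_ln p0) d1.
have -> : sigma s%:E = s^-1 *: (@ln R \o (fun z : R => 1 + s^-1 * expR (s * z))).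
  by [].
apply: (is_derive_eq (is_deriveZ s^-1 d2)); rewrite /GRing.scale /= /dsigma.
by field; rewrite !gt_eqF// addr_gt0.
Qed.

Lemma is_derive_dsigma s x : 0 < s ->
  is_derive x 1 (dsigma s%:E) (s ^+ 2 * expR (s * x) / (s + expR (s * x)) ^+ 2).
Proof.
move=> s0; have e0 := expR_gt0 (s * x).
have p0 : s + expR (s * x) != 0 by rewrite gt_eqF// addr_gt0.
have de := is_derive_expR_linear s x.
have dp : is_derive x 1 (fun z : R => s + expR (s * z)) (s * expR (s * x)).
  have -> : (fun z : R => s + expR (s * z)) = cst s + (fun z : R => expR (s * z)) by [].
  by apply: is_derive_eq; rewrite add0r.
have dV := is_deriveV (f := fun z : R => s + expR (s * z)) p0 dp.
have -> : dsigma s%:E =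
  (fun z : R => expR (s * z)) * (fun z : R => (s + expR (s * z))^-1) by [].
apply: is_derive_eq; rewrite /GRing.scale /=.
by field.
Qed.

Lemma dsigma_ge0_le1 s x : 0 < s -> 0 <= dsigma s%:E x <= 1.
Proof.
move=> s0; have e0 := expR_gt0 (s * x); have p0 := addr_gt0 s0 e0.
rewrite /dsigma ler_pdivrMr// mul1r lerDr (ltW s0) andbT.
by apply: divr_ge0; exact: ltW.
Qed.

Lemma dsigma_norm_le1 s x : 0 < s -> `|dsigma s%:E x| <= 1.
Proof. by move=> /(dsigma_ge0_le1 x)/andP[d0 d1]; rewrite ger0_norm. Qed.

Lemma is_derive_continuous (f df : R -> R) :
  (forall x, is_derive x 1 f (df x)) -> continuous f.
Proof.
move=> dff x; apply: differentiable_continuous.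
by apply/derivable1_diffP; apply: ex_derive.
Qed.

(** The endpoints come in either order; of the intermediate point only its distance to [a] matters
    for the Taylor bound. *)
Lemma derivable_MVT (f df : R -> R) a b :
  (forall x, is_derive x 1 f (df x)) ->
  exists2 c, `|c - a| <= `|b - a| & f b - f a = df c * (b - a).
Proof.
move=> dff; have cf := is_derive_continuous dff.
have [ab|/ltW ba] := leP a b.
  have [|c cab ->] := MVT_segment ab (fun x _ => dff x); first exact: continuous_subspaceT.
  exists c => //; move: cab; rewrite in_itv/= => /andP[ac cb].
  by rewrite !ger0_norm ?subr_ge0// lerD2r.
have [|c cab fE] := MVT_segment ba (fun x _ => dff x); first exact: continuous_subspaceT.
exists c; last by rewrite -opprB fE -mulrN opprB.
move: cab; rewrite in_itv/= => /andP[bc ca].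
by rewrite !ler0_norm ?subr_le0// lerN2 lerD2r.
Qed.

Lemma sigma_lipschitz s a b : 0 < s ->
  `|sigma s%:E b - sigma s%:E a| <= `|b - a|.
Proof.
move=> s0; have [c _ ->] := derivable_MVT a b (fun x => is_derive_sigma x s0).
by rewrite normrM ler_piMl// dsigma_norm_le1.
Qed.

(** With E = exp(s x), the derivative s^2 E / (s + E)^2 is at most s because s E <= (s + E)^2. The
    constant grows with s, so this regularity does not pass to the limit. *)
Lemma dsigma_lipschitz s a b : 0 < s ->
  `|dsigma s%:E b - dsigma s%:E a| <= s * `|b - a|.
Proof.
move=> s0; have [c _ ->] := derivable_MVT a b (fun x => is_derive_dsigma x s0).
rewrite normrM ler_wpM2r//; have e0 := expR_gt0 (s * c).
rewrite ger0_norm; last by rewrite divr_ge0 ?mulr_ge0 ?exprn_ge0 ?addr_ge0// ltW.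
by rewrite ler_pdivrMr ?exprn_gt0 ?addr_gt0//; nra.
Qed.

(** The mean value theorem gives the slope at an intermediate point; moving it to [a] costs the
    Lipschitz constant of the derivative. *)
Lemma sigma_taylor s a b : 0 < s ->
  `|sigma s%:E b - sigma s%:E a - dsigma s%:E a * (b - a)| <= s * `|b - a| ^+ 2.
Proof.
move=> s0; have [c cab ->] := derivable_MVT a b (fun x => is_derive_sigma x s0).
rewrite -mulrBl normrM expr2 mulrA ler_wpM2r//.
apply: le_trans (dsigma_lipschitz _ _ s0) _.
by rewrite ler_pM2l.
Qed.

Lemma continuous_sigma s : 0 < s -> continuous (sigma s%:E).
Proof. by move=> s0; exact: is_derive_continuous (fun x => is_derive_sigma x s0). Qed.

Lemma continuous_dsigma s : 0 < s -> continuous (dsigma s%:E).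
Proof. by move=> s0; exact: is_derive_continuous (fun x => is_derive_dsigma x s0). Qed.

(** * Bounds uniform in s and limits of the activations as s grows *)

Lemma sigma_ge0 s x : 0 < s -> 0 <= sigma s%:E x.
Proof.
move=> s0; rewrite /sigma mulr_ge0 ?invr_ge0 ?ln_ge0 ?ltW//.
by rewrite ltrDl mulr_gt0 ?invr_gt0 ?expR_gt0.
Qed.

Lemma sigma_le s x : 1 <= s -> sigma s%:E x <= Num.max x 0 + s^-1.
Proof.
move=> s1; have s0 : 0 < s by exact: lt_le_trans s1.
(* Multiplying by s and exponentiating, with m = max(x, 0), the claim reads 1 + exp(s x) / s <=
   exp(s m + 1). The left side is at most 2 exp(s m), and 2 <= e. *)
rewrite /sigma -(ler_pM2l s0) mulrA mulfV ?gt_eqF// mul1r mulrDr mulfV ?gt_eqF//.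
rewrite -ler_expR lnK; last first.
  by rewrite posrE addr_gt0// mulr_gt0 ?invr_gt0 ?expR_gt0.
set m := Num.max x 0.
have m0 : 0 <= m by rewrite le_max lexx orbT.
have em : 1 <= expR (s * m) by rewrite -expR0 ler_expR mulr_ge0// ltW.
have ex : expR (s * x) <= expR (s * m) by rewrite ler_expR ler_pM2l// le_max lexx.
have sx : s^-1 * expR (s * x) <= expR (s * m).
  by apply: le_trans ex; rewrite ler_piMl ?expR_ge0// invf_le1.
have e2 : 2 <= expR 1 :> R by have := expR_ge1Dx (1 : R); lra.
rewrite expRD; nra.
Qed.

Lemma sigma_norm_le s x : 1 <= s -> `|sigma s%:E x| <= `|x| + 1.
Proof.
move=> s1; have s0 : 0 < s by exact: lt_le_trans s1.
rewrite ger0_norm ?sigma_ge0//; apply: le_trans (sigma_le x s1) _.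
by rewrite lerD ?invf_le1// ge_max ler_norm normr_ge0.
Qed.

Lemma expR_ge_sqr x : 0 <= x -> x ^+ 2 / 2 <= expR x.
Proof.
move=> x0; apply: le_trans (expR_ge1Dxn 1 x0).
by rewrite (_ : 2`!%:R = 2)// lerDr.
Qed.

Lemma sigma_near_relu (e s x : R) : 0 < e -> 1 <= s -> 2 / e ^+ 2 <= s -> e^-1 <= s ->
  `|Num.max x 0 - sigma s%:E x| <= e.
Proof.
move=> e0 s1 se2 se; have s0 : 0 < s by exact: lt_le_trans s1.
have up := sigma_le x s1.
have lo0 := sigma_ge0 x s0.
have sVe : s^-1 <= e by rewrite -[e]invrK lef_pV2 ?posrE ?invr_gt0.
(* Dropping the summand 1 in the logarithm leaves x - ln(s) / s, so s <= exp(s e) suffices; this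
   follows from s <= (s e)^2 / 2, that is, from 2 <= s e^2. *)
have lo : x - e <= sigma s%:E x.
  rewrite /sigma -(ler_pM2l s0) mulrA mulfV ?gt_eqF// mul1r.
  rewrite -ler_expR lnK; last first.
    by rewrite posrE addr_gt0// mulr_gt0 ?invr_gt0 ?expR_gt0.
  rewrite mulrBr expRD expRN.
  have sle : s <= expR (s * e).
    apply: le_trans (expR_ge_sqr (mulr_ge0 (ltW s0) (ltW e0))).
    have : 2 <= s * e ^+ 2 by rewrite -ler_pdivrMr// exprn_gt0.
    by nra.
  apply: (@le_trans _ _ (s^-1 * expR (s * x))); last by rewrite lerDr.
  by rewrite mulrC ler_wpM2r ?expR_ge0// lef_pV2 ?posrE// expR_gt0.
by rewrite ler_norml; case: (leP x 0) up => _ up; apply/andP; split; lra.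
Qed.

(** With E = exp(s x) the distance is s / (s + E), so s <= e E suffices, and E >= (s x)^2 / 2. The
    threshold blows up as x tends to 0: the convergence is only pointwise. *)
Lemma dsigma_near_step (e s x : R) : 0 < e -> 0 < x ->
  1 <= s -> 2 / (e * x ^+ 2) <= s -> `|1 - dsigma s%:E x| <= e.
Proof.
move=> e0 x0 s1 sA; have s0 : 0 < s by exact: lt_le_trans s1.
have /andP[_ d1] := dsigma_ge0_le1 x s0.
rewrite ger0_norm ?subr_ge0// lerBlDr -lerBlDl /dsigma.
have E0 := expR_gt0 (s * x).
rewrite ler_pdivlMr ?addr_gt0//.
have : s ^+ 2 * x ^+ 2 / 2 <= expR (s * x).
  by rewrite -exprMn; apply: expR_ge_sqr; rewrite mulr_ge0// ltW.
have : 2 <= s * (e * x ^+ 2) by rewrite -ler_pdivrMr// mulr_gt0// exprn_gt0.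
set E := expR _ in E0 *; set q := x ^+ 2.
move=> h1 h2.
have h3 : s <= e * E.
  apply: le_trans (_ : e * (s ^+ 2 * q / 2) <= _); last by rewrite ler_pM2l.
  by nra.
by nra.
Qed.

(** The factor 1/r inside the logarithm of the activation acts here: at x = 0 the derivative is 1 /
    (s + 1), which tends to 0, whereas the usual softplus would give 1/2. *)
Lemma dsigma_le_inv s x : 1 <= s -> x <= 0 -> dsigma s%:E x <= s^-1.
Proof.
move=> s1 x0; have s0 : 0 < s by exact: lt_le_trans s1.
have E0 := expR_gt0 (s * x).
have E1 : expR (s * x) <= 1 by rewrite -expR0 ler_expR mulr_ge0_le0// ltW.
rewrite /dsigma ler_pdivrMr ?addr_gt0// mulrDr mulVf ?gt_eqF// ler_wpDr//.
by rewrite mulr_ge0 ?expR_ge0// invr_ge0 ltW.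
Qed.

Lemma cvg_succn_dist (f : R -> R) l :
  (forall e, 0 < e -> exists A, forall s, 1 <= s -> A <= s -> `|l - f s| <= e) ->
  f n.+1%:R @[n --> \oo] --> l.
Proof.
move=> fl; apply/cvgrPdist_le => e e0; have [A fA] := fl _ e0.
near=> n; apply: fA; first by rewrite ler1n.
apply: (@le_trans _ _ n%:R); last by rewrite ler_nat.
by near: n; exact: nbhs_infty_ger.
Unshelve. all: by end_near. Qed.

Lemma cvg_sigma x : sigma (n.+1%:R)%:E x @[n --> \oo] --> sigma +oo%E x.
Proof.
apply: (@cvg_succn_dist (fun s => sigma s%:E x)) => e e0.
exists (Num.max (2 / e ^+ 2) e^-1) => s s1; rewrite ge_max => /andP[se2 se].
exact: sigma_near_relu.
Qed.

Lemma cvg_dsigma x : dsigma (n.+1%:R)%:E x @[n --> \oo] --> dsigma +oo%E x.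
Proof.
apply: (@cvg_succn_dist (fun s => dsigma s%:E x)) => e e0.
rewrite /(dsigma +oo%E); have [x0|x0] /= := ltP 0 x.
  by exists (2 / (e * x ^+ 2)) => s s1 sA; exact: dsigma_near_step.
exists e^-1 => s s1 se; have s0 : 0 < s by exact: lt_le_trans s1.
have /andP[d0 _] := dsigma_ge0_le1 x s0.
rewrite sub0r normrN ger0_norm//; apply: le_trans (dsigma_le_inv s1 x0) _.
by rewrite -[e]invrK lef_pV2 ?posrE ?invr_gt0.
Qed.

End softplus.

(** * Functions with Lipschitz gradient *)

Section uniformly_C11.
Context {R : realType} {n : nat}.
Local Notation V := 'rV[R]_n.
Local Notation mu := (@lebesgue_measure R).
Implicit Types (f : R -> V -> R) (g : R -> V -> V) (y M C : R) (phi psi : V).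

(* [g y] plays the role of the gradient of [f y]; the constant does not depend on
   the parameter y in [0, 1]. *)
Definition taylor_bounds (M C : R) f g : Prop :=
  forall y phi psi, y \in `[0, 1]%R -> `|phi| <= M -> `|psi| <= M ->
  [/\ `|f y phi| <= C, `|g y phi| <= C,
      `|f y psi - f y phi| <= C * `|psi - phi|,
      `|g y psi - g y phi| <= C * `|psi - phi| &
      `|f y psi - f y phi - dot (g y phi) (psi - phi)| <= C * `|psi - phi| ^+ 2].

(** Continuity in y makes the integrands over y measurable. Functions of phi alone enter with a
    dummy parameter, so one calculus serves the network, the risk and the Lyapunov function. *)
Definition c11 f g : Prop :=
  [/\ forall phi, continuous (f^~ phi),
      forall phi i, continuous (fun y => g y phi ord0 i) &
      forall M, exists2 C, 0 <= C & taylor_bounds M C f g].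

Lemma c11_ext f f' g g' : (forall y phi, f y phi = f' y phi) ->
  (forall y phi, g y phi = g' y phi) -> c11 f g -> c11 f' g'.
Proof.
move=> ff' gg'; suff -> : f = f' by suff -> : g = g' by [];
  apply/funext => y; apply/funext => phi.
by apply/funext => y; apply/funext => phi.
Qed.

Lemma c11_cst (h : R -> R) :
  continuous h -> c11 (fun y _ => h y) (fun _ _ => 0).
Proof.
move=> ch; split=> [phi|phi i|M]; first exact: ch.
  by move=> y; under eq_fun do rewrite mxE; exact: cvg_cst.
have [_ [C hC]] : bmeas 0 1 h by exact/bmeas_continuous/continuous_subspaceT.
exists `|C| => // y phi psi y01 _ _.
rewrite !subrr dot0l subrr !normr0 !mulr_ge0//; split=> //.
by rewrite (le_trans (hC _ y01))// ler_norm.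
Qed.

Lemma c11_coord i : c11 (fun _ phi => phi ord0 i) (fun _ _ => delta_mx ord0 i).
Proof.
split=> [phi|phi j|M].
- by move=> y; exact: cvg_cst.
- by move=> y; exact: cvg_cst.
exists (`|M| + 1); first by rewrite addr_ge0.
move=> y phi psi _ phiM _.
have H0 : 0 <= `|M| + 1 :> R by rewrite addr_ge0.
rewrite subrr normr0 dot_delta !mxE subrr normr0 !mulr_ge0//; split=> //.
- apply: le_trans (ler_coord_norm _ _) _; apply: le_trans phiM _.
  by rewrite (le_trans (ler_norm M))// lerDl.
- apply: row_norm_le => // j; rewrite mxE eqxx /=.
  by case: eqP => _; rewrite ?normr0 ?normr1 ?lerDr.
- have -> : psi ord0 i - phi ord0 i = (psi - phi) ord0 i by rewrite !mxE.
  apply: le_trans (ler_coord_norm _ _) _.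
  by rewrite ler_peMl// lerDr.
Qed.

Lemma c11D f1 g1 f2 g2 : c11 f1 g1 -> c11 f2 g2 ->
  c11 (fun y phi => f1 y phi + f2 y phi) (fun y phi => g1 y phi + g2 y phi).
Proof.
move=> [cf1 cg1 T1] [cf2 cg2 T2]; split=> [phi|phi i|M].
- by move=> y; apply: cvgD; [exact: cf1|exact: cf2].
- move=> y; under eq_fun do rewrite mxE.
  by apply: cvgD; [exact: cg1|exact: cg2].
have [C1 C10 B1] := T1 M; have [C2 C20 B2] := T2 M.
exists (C1 + C2); first exact: addr_ge0.
move=> y phi psi y01 phiM psiM.
have [a1 b1 c1 d1 e1] := B1 y phi psi y01 phiM psiM.
have [a2 b2 c2 d2 e2] := B2 y phi psi y01 phiM psiM.
rewrite !mulrDl dotDl; split.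
- by apply: le_trans (ler_normD _ _) _; exact: lerD.
- by apply: le_trans (ler_normD _ _) _; exact: lerD.
- by rewrite opprD addrACA; apply: le_trans (ler_normD _ _) _; exact: lerD.
- by rewrite opprD addrACA; apply: le_trans (ler_normD _ _) _; exact: lerD.
- have -> : f1 y psi + f2 y psi - (f1 y phi + f2 y phi) -
    (dot (g1 y phi) (psi - phi) + dot (g2 y phi) (psi - phi)) =
    (f1 y psi - f1 y phi - dot (g1 y phi) (psi - phi)) +
    (f2 y psi - f2 y phi - dot (g2 y phi) (psi - phi)) by ring.
  by apply: le_trans (ler_normD _ _) _; exact: lerD.
Qed.

Lemma c11M f1 g1 f2 g2 : c11 f1 g1 -> c11 f2 g2 ->
  c11 (fun y phi => f1 y phi * f2 y phi)
      (fun y phi => f1 y phi *: g2 y phi + f2 y phi *: g1 y phi).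
Proof.
move=> [cf1 cg1 T1] [cf2 cg2 T2]; split=> [phi|phi i|M].
- by move=> y; apply: cvgM; [exact: cf1|exact: cf2].
- move=> y; under eq_fun do rewrite !mxE.
  by apply: cvgD; apply: cvgM; [exact: cf1|exact: cg2|exact: cf2|exact: cg1].
have [C1 C10 B1] := T1 M; have [C2 C20 B2] := T2 M.
have C120 : 0 <= C1 * C2 by exact: mulr_ge0.
(* The worst case is the increment of the gradient, which splits into four products, each at most C1
   C2 |psi - phi|. *)
exists (4 * (C1 * C2)); first by rewrite mulr_ge0.
move=> y phi psi y01 phiM psiM.
have [a1 b1 c1 d1 e1] := B1 y phi psi y01 phiM psiM.
have [a2 b2 c2 d2 e2] := B2 y phi psi y01 phiM psiM.
have [A1 _ _ _ _] := B1 y psi psi y01 psiM psiM.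
have [A2 _ _ _ _] := B2 y psi psi y01 psiM psiM.
set h := `|psi - phi| in c1 d1 e1 c2 d2 e2 *.
have h0 : 0 <= h by exact: normr_ge0.
have mul (a b : R) A B : `|a| <= A -> `|b| <= B -> `|a * b| <= A * B.
  by move=> aA bB; rewrite normrM ler_pM.
have scl (a : R) (b : V) A B : `|a| <= A -> `|b| <= B -> `|a *: b| <= A * B.
  by move=> aA bB; rewrite normrZ ler_pM.
split.
- by apply: le_trans (mul _ _ _ _ a1 a2) _; lra.
- apply: le_trans (ler_normD _ _) _.
  by have := scl _ _ _ _ a1 b2; have := scl _ _ _ _ a2 b1; lra.
- have -> : f1 y psi * f2 y psi - f1 y phi * f2 y phi =
    f1 y psi * (f2 y psi - f2 y phi) + (f1 y psi - f1 y phi) * f2 y phi by ring.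
  apply: le_trans (ler_normD _ _) _.
  have := mul _ _ _ _ A1 c2; have := mul _ _ _ _ c1 a2.
  have := mulr_ge0 C120 h0; lra.
- have -> : f1 y psi *: g2 y psi + f2 y psi *: g1 y psi -
     (f1 y phi *: g2 y phi + f2 y phi *: g1 y phi) =
    (f1 y psi *: (g2 y psi - g2 y phi) + (f1 y psi - f1 y phi) *: g2 y phi) +
    (f2 y psi *: (g1 y psi - g1 y phi) + (f2 y psi - f2 y phi) *: g1 y phi).
    by apply/rowP => i; rewrite !mxE; ring.
  apply: le_trans (ler_normD _ _) _.
  have := ler_normD (f1 y psi *: (g2 y psi - g2 y phi)) ((f1 y psi - f1 y phi) *: g2 y phi).
  have := ler_normD (f2 y psi *: (g1 y psi - g1 y phi)) ((f2 y psi - f2 y phi) *: g1 y phi).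
  have := scl _ _ _ _ A1 d2; have := scl _ _ _ _ c1 b2.
  have := scl _ _ _ _ A2 d1; have := scl _ _ _ _ c2 b1.
  lra.
- rewrite dotDl !dotZl.
  set D1 := dot (g1 _ _) _ in e1 *; set D2 := dot (g2 _ _) _ in e2 *.
  have -> : f1 y psi * f2 y psi - f1 y phi * f2 y phi -
      (f1 y phi * D2 + f2 y phi * D1) =
    (f1 y psi - f1 y phi) * (f2 y psi - f2 y phi) +
    (f1 y phi * (f2 y psi - f2 y phi - D2) + f2 y phi * (f1 y psi - f1 y phi - D1)).
    by ring.
  apply: le_trans (ler_normD _ _) _.
  have := ler_normD (f1 y phi * (f2 y psi - f2 y phi - D2))
    (f2 y phi * (f1 y psi - f1 y phi - D1)).
  have := mul _ _ _ _ c1 c2; have := mul _ _ _ _ a1 e2; have := mul _ _ _ _ a2 e1.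
  have := mulr_ge0 C120 (exprn_ge0 2 h0); lra.
Qed.

Lemma c11_sum (I : Type) (s : seq I) (F : I -> R -> V -> R) (G : I -> R -> V -> V) :
  (forall i, c11 (F i) (G i)) ->
  c11 (fun y phi => \sum_(i <- s) F i y phi) (fun y phi => \sum_(i <- s) G i y phi).
Proof.
move=> FG; elim: s => [|i s IH].
  apply: c11_ext (c11_cst (h := fun=> 0) _) => [y phi|y phi|y].
  - by rewrite big_nil.
  - by rewrite big_nil.
  - exact: cvg_cst.
by apply: c11_ext (c11D (FG i) IH) => y phi; rewrite big_cons.
Qed.

Lemma c11_sigma s f g : 1 <= s -> c11 f g ->
  c11 (fun y phi => sigma s%:E (f y phi))
      (fun y phi => dsigma s%:E (f y phi) *: g y phi).
Proof.
move=> s1 [cf cg T]; have s0 : 0 < s by exact: lt_le_trans s1.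
split=> [phi|phi i|M].
- by move=> y; apply: continuous_comp; [exact: cf|exact: continuous_sigma].
- move=> y; under eq_fun do rewrite !mxE.
  apply: cvgM; last exact: cg.
  by apply: continuous_comp; [exact: cf|exact: continuous_dsigma].
have [C C0 B] := T M.
have sC : 0 <= s * C ^+ 2 by rewrite mulr_ge0 ?exprn_ge0// ltW.
(* C + 1 bounds the value; [s * C ^+ 2] arises when the s-Lipschitz [dsigma] is composed with [f]
   and multiplied by [g], and again in the Taylor remainder. *)
exists (C + 1 + s * C ^+ 2); first by rewrite !addr_ge0.
move=> y phi psi y01 phiM psiM.
have [a b c d e] := B y phi psi y01 phiM psiM.
set h := `|psi - phi| in c d e *.
have h0 : 0 <= h by exact: normr_ge0.
have dle x : `|dsigma s%:E x| <= 1 by exact: dsigma_norm_le1.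
split.
- by apply: le_trans (sigma_norm_le _ s1) _; lra.
- rewrite normrZ; have := ler_pM (normr_ge0 _) (normr_ge0 _) (dle (f y phi)) b.
  lra.
- apply: le_trans (sigma_lipschitz _ _ s0) _; apply: le_trans c _.
  by rewrite ler_wpM2r//; lra.
- have -> : dsigma s%:E (f y psi) *: g y psi - dsigma s%:E (f y phi) *: g y phi =
    dsigma s%:E (f y psi) *: (g y psi - g y phi) +
    (dsigma s%:E (f y psi) - dsigma s%:E (f y phi)) *: g y phi.
    by apply/rowP => i; rewrite !mxE; ring.
  apply: le_trans (ler_normD _ _) _.
  rewrite normrZ (normrZ (_ - _)).
  have := ler_pM (normr_ge0 _) (normr_ge0 _) (dle (f y psi)) d.
  have dl : `|dsigma s%:E (f y psi) - dsigma s%:E (f y phi)| <= s * (C * h).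
    by apply: le_trans (dsigma_lipschitz _ _ s0) _; rewrite ler_pM2l.
  have := ler_pM (normr_ge0 _) (normr_ge0 _) dl b.
  by rewrite !mulrDl expr2; lra.
- rewrite dotZl; set D := dot _ _ in e *.
  set p := f y phi in a c e *; set q := f y psi in c e *.
  have -> : sigma s%:E q - sigma s%:E p - dsigma s%:E p * D =
    (sigma s%:E q - sigma s%:E p - dsigma s%:E p * (q - p)) +
    dsigma s%:E p * (q - p - D) by ring.
  apply: le_trans (ler_normD _ _) _; rewrite normrM.
  have := ler_pM (normr_ge0 _) (normr_ge0 _) (dle p) e.
  have : `|sigma s%:E q - sigma s%:E p - dsigma s%:E p * (q - p)| <= s * (C * h) ^+ 2.
    apply: le_trans (sigma_taylor _ _ s0) _.
    by rewrite ler_pM2l// lerXn2r ?nnegrE ?mulr_ge0.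
  have := exprn_ge0 2 h0.
  by rewrite !mulrDl exprMn; lra.
Qed.

Lemma c11_bmeas f g phi : c11 f g ->
  bmeas 0 1 (f^~ phi) /\ forall i, bmeas 0 1 (fun y => g y phi ord0 i).
Proof.
move=> [cf cg _]; split=> [|i]; apply/bmeas_continuous/continuous_subspaceT.
  exact: cf.
exact: cg.
Qed.

Lemma dot_Rintegral (a b : R) (F : R -> 'I_n -> R) h :
  (forall i, bmeas a b (F^~ i)) ->
  dot (\row_i \int[mu]_(y in `[a, b]) F y i) h =
  \int[mu]_(y in `[a, b]) dot (\row_i F y i) h.
Proof.
move=> mF; rewrite /dot Rintegral_sum_bmeas; last first.
  by move=> i; under eq_fun do rewrite mxE; exact: bmeasM (mF i) (bmeas_cst _ _ _).
apply: eq_bigr => i _; rewrite mxE mulrC -RintegralZ_bmeas//.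
by apply: eq_Rintegral => y _; rewrite mxE mulrC.
Qed.

(** Differentiation under the integral sign: the bounds are uniform in y and [0, 1] has length 1, so
    they integrate with the same constant. *)
Lemma c11_Rintegral f g : c11 f g ->
  c11 (fun _ phi => \int[mu]_(y in `[0, 1]) f y phi)
      (fun _ phi => \row_i \int[mu]_(y in `[0, 1]) g y phi ord0 i).
Proof.
move=> fg; have [cf cg T] := fg.
split=> [phi|phi i|M]; [by move=> y; exact: cvg_cst|by move=> y; exact: cvg_cst|].
have [C C0 B] := T M; exists C => // _ phi psi _ phiM psiM.
have bd (F : R -> R) D : bmeas 0 1 F ->
    (forall y, y \in `[0, 1]%R -> `|F y| <= D) ->
    `|\int[mu]_(y in `[0, 1]) F y| <= D.
  by move=> mF FD; have := normr_Rintegral_le ler01 mF FD; rewrite subr0 mulr1.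
have [mf mg] := c11_bmeas phi fg; have [mf' mg'] := c11_bmeas psi fg.
have mN1 F : bmeas 0 1 F -> bmeas 0 1 (fun y => - F y).
  by move=> mF; under eq_fun do rewrite -mulN1r; exact: bmeasM (bmeas_cst _ _ _) mF.
split.
- by apply: bd => // y y01; have [] := B y phi psi y01 phiM psiM.
- apply: row_norm_le => // i; rewrite mxE; apply: bd => // y y01.
  have [_ b _ _ _] := B y phi psi y01 phiM psiM.
  exact: le_trans (ler_coord_norm _ _) b.
- rewrite -RintegralB_bmeas//; apply: bd; first by apply: bmeasD => //; exact: mN1.
  by move=> y y01; have [] := B y phi psi y01 phiM psiM.
- apply: row_norm_le; first exact: mulr_ge0.
  move=> i; rewrite !mxE -RintegralB_bmeas//.
  apply: bd; first by apply: bmeasD => //; exact: mN1.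
  move=> y y01; have [_ _ _ d _] := B y phi psi y01 phiM psiM.
  have -> : g y psi ord0 i - g y phi ord0 i = (g y psi - g y phi) ord0 i by rewrite !mxE.
  exact: le_trans (ler_coord_norm _ _) d.
- rewrite -RintegralB_bmeas//.
  have mdot i : bmeas 0 1 (fun y => g y phi ord0 i * (psi - phi) ord0 i).
    exact: bmeasM (mg i) (bmeas_cst _ _ _).
  rewrite dot_Rintegral//.
  have rowE y : \row_i g y phi ord0 i = g y phi by apply/rowP => i; rewrite mxE.
  under [X in _ - X]eq_Rintegral do rewrite rowE.
  have mdots : bmeas 0 1 (fun y => dot (g y phi) (psi - phi)) by exact: bmeas_sum.
  rewrite -RintegralB_bmeas//; last by apply: bmeasD => //; exact: mN1.
  apply: bd; first by apply: bmeasD; [apply: bmeasD => //; exact: mN1|exact: mN1].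
  by move=> y y01; have [] := B y phi psi y01 phiM psiM.
Qed.

End uniformly_C11.

(** * The chain rule along integral curves *)

Section gradient_flows.
Context {R : realType} {n : nat}.
Local Notation V := 'rV[R]_n.+1.
Local Notation mu := (@lebesgue_measure R).
Implicit Types (f : V -> R) (g : V -> V) (phi psi : V).

Lemma c11_bounds f g M : c11 (fun _ => f) (fun _ => g) ->
  exists2 C : R, 0 <= C & forall phi psi, `|phi| <= M -> `|psi| <= M ->
  [/\ `|f phi| <= C, `|g phi| <= C, `|g psi - g phi| <= C * `|psi - phi| &
      `|f psi - f phi - dot (g phi) (psi - phi)| <= C * `|psi - phi| ^+ 2].
Proof.
move=> [_ _ /(_ M)[C C0 B]]; exists C => // phi psi phiM psiM.
have y0 : (0 : R) \in `[0, 1]%R by rewrite in_itv/= lexx ler01.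
by have [] := B 0 phi psi y0 phiM psiM.
Qed.

Lemma c11_gradE f g phi : c11 (fun _ => f) (fun _ => g) -> grad f phi = g phi.
Proof.
move=> fg; apply/rowP => i; rewrite mxE /derive.
set v := delta_mx ord0 i.
have v1 : `|v| <= 1 :> R.
  apply: row_norm_le => // j; rewrite mxE eqxx /=.
  by case: eqP => _; rewrite ?normr0 ?normr1.
apply: cvg_lim => //; apply/cvgrPdist_le => e e0.
have [C C0 B] := c11_bounds (`|phi| + 1) fg.
near=> h.
have h0 : h != 0 by near: h; exact: nbhs_dnbhs_neq.
have h1 : `|h| <= 1 by near: h; apply: dnbhs0_le.
(* The difference quotient is off by at most C |h|; C + 1 avoids a division by zero. *)
have he : `|h| <= e / (C + 1).
  by near: h; apply: dnbhs0_le; rewrite divr_gt0// ltr_wpDl.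
have hv : `|h *: v| <= `|h| by rewrite normrZ ler_piMr.
have hM : `|h *: v + phi| <= `|phi| + 1.
  by apply: le_trans (ler_normD _ _) _; rewrite addrC lerD2l (le_trans hv).
have phiM : `|phi| <= `|phi| + 1 by rewrite lerDl.
have [_ _ _] := B _ _ phiM hM.
rewrite addrK dotC dotZl dot_delta => fh.
rewrite /= -(ler_pM2l (_ : 0 < `|h|)) ?normr_gt0// -normrM mulrBr.
rewrite /GRing.scale /= mulrA mulfV// mul1r distrC.
apply: le_trans fh _; apply: (@le_trans _ _ (C * `|h| ^+ 2)).
  by rewrite ler_wpM2l// lerXn2r ?nnegrE.
rewrite expr2 mulrCA ler_wpM2l//.
move: he; rewrite ler_pdivlMr ?ltr_wpDl// mulrDr mulr1 mulrC.
by have := normr_ge0 h; lra.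
Unshelve. all: by end_near. Qed.

Lemma c11_continuous_grad f g i :
  c11 (fun _ => f) (fun _ => g) -> continuous (fun phi => g phi ord0 i).
Proof.
move=> fg phi; apply/(@cvgrPdist_le _ _ _ (nbhs phi) (nbhs_filter phi)) => e e0.
have [C C0 B] := c11_bounds (`|phi| + 1) fg.
have near_le r : 0 < r -> \forall psi \near phi, `|phi - psi| <= r.
  move=> r0; apply: filterS (nbhsx_ballx phi _ r0) => psi.
  by rewrite -ball_normE; exact: ltW.
near=> psi.
have d1 : `|phi - psi| <= 1 by near: psi; exact: near_le.
have de : `|phi - psi| <= e / (C + 1).
  by near: psi; apply: near_le; rewrite divr_gt0// ltr_wpDl.
have psiM : `|psi| <= `|phi| + 1.
  rewrite -[psi](subrK phi) addrC; apply: le_trans (ler_normD _ _) _.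
  by rewrite lerD2l distrC.
have phiM : `|phi| <= `|phi| + 1 by rewrite lerDl.
have [_ _ gl _] := B _ _ psiM phiM.
have -> : g phi ord0 i - g psi ord0 i = (g phi - g psi) ord0 i by rewrite !mxE.
apply: le_trans (ler_coord_norm _ _) _; apply: le_trans gl _.
move: de; rewrite ler_pdivlMr ?ltr_wpDl// mulrDr mulr1 mulrC.
by have := normr_ge0 (phi - psi); lra.
Unshelve. all: by end_near. Qed.

(** On a partition of [0, T] into N + 1 equal pieces the increments add up to at most K T^2 / (N +
    1), which is arbitrarily small. *)
Lemma quadratic_increments_cst (F : R -> R) (K T : R) : 0 <= T ->
  (forall s t, 0 <= s -> s <= t -> t <= T -> `|F t - F s| <= K * (t - s) ^+ 2) ->
  F T = F 0.
Proof.
move=> T0 FK.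
have bound (N : nat) : `|F T - F 0| <= K * T ^+ 2 / N.+1%:R.
  pose u k := F (T * (k%:R / N.+1%:R)).
  have N0 : N.+1%:R != 0 :> R by rewrite pnatr_eq0.
  have -> : F T - F 0 = u N.+1 - u 0%N by rewrite /u divff// mul0r mulr0 mulr1.
  rewrite -telescope_sumr//; apply: le_trans (ler_norm_sum _ _ _) _.
  have -> : K * T ^+ 2 / N.+1%:R = \sum_(0 <= k < N.+1) K * (T / N.+1%:R) ^+ 2.
    by rewrite big_mkord sumr_const card_ord -mulr_natr; field.
  rewrite !big_mkord; apply: ler_sum => k _.
  have := FK (T * (k%:R / N.+1%:R)) (T * (k.+1%:R / N.+1%:R)).
  have -> : T * (k.+1%:R / N.+1%:R) - T * (k%:R / N.+1%:R) = T / N.+1%:R.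
    by rewrite -natr1; field.
  apply.
  - by rewrite mulr_ge0// divr_ge0.
  - by rewrite ler_wpM2l// ler_wpM2r ?invr_ge0// ler_nat.
  - by rewrite ler_piMr// ler_pdivrMr// mul1r ler_nat.
apply/eqP; rewrite -subr_eq0 -normr_eq0 eq_le normr_ge0 andbT leNgt.
apply/negP => d0.
have c0 : 0 <= K * T ^+ 2 by have := bound 0%N; rewrite divr1; lra.
(* A k with 1 / (k + 1) < |F T - F 0| / (K T^2 + 1) contradicts [bound k]. *)
have [k] := ltr_add_invr (divr_gt0 d0 (ltr_wpDl c0 ltr01)).
rewrite add0r ltr_pdivlMr ?ltr_wpDl// mulrDr mulr1 => kd.
have := lt_le_trans kd (bound k).
by rewrite [X in X + _]mulrC gtrDl invr_lt0 ltrn0.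
Qed.

Lemma bmeas_dot (a b : R) (x y : R -> V) :
  (forall i, bmeas a b (fun s => x s ord0 i)) ->
  (forall i, bmeas a b (fun s => y s ord0 i)) ->
  bmeas a b (fun s => dot (x s) (y s)).
Proof. by move=> bx bY; apply: bmeas_sum => i; exact: bmeasM. Qed.

Lemma bmeas_norm_bound (a b : R) (x : R -> V) :
  (forall i, bmeas a b (fun s => x s ord0 i)) ->
  exists2 C, 0 <= C & forall s, s \in `[a, b]%R -> `|x s| <= C.
Proof.
move=> bx.
have /(_ _)/cid-/all_sig[C xC] : forall i, exists C,
    forall s, s \in `[a, b]%R -> `|x s ord0 i| <= C by move=> i; case: (bx i).
exists (\sum_i `|C i|); first exact: sumr_ge0.
move=> s sab; apply: row_norm_le; first exact: sumr_ge0.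
move=> i; rewrite (bigD1 i)//=; apply: le_trans (xC i _ sab) _.
by apply: le_trans (ler_norm _) _; rewrite lerDl sumr_ge0.
Qed.

Section chain_rule.
Variables (T : R) (Theta v : R -> V).
Hypothesis Theta_cont : {within `[0, T], continuous Theta}.
Hypothesis bv : forall i, bmeas 0 T (fun s => v s ord0 i).
Hypothesis Theta_flow : forall t, 0 <= t -> t <= T ->
  Theta t = Theta 0 - row_integral 0 t v.

Lemma bmeas_comp_curve (h : V -> R) : continuous h -> bmeas 0 T (h \o Theta).
Proof.
move=> ch; apply: bmeas_continuous => x.
apply: (@continuous_comp _ _ _ (from_subspace `[0, T] Theta) h).
  exact: Theta_cont.
exact: ch.
Qed.

Lemma flow_increment s t i : 0 <= s -> s <= t -> t <= T ->
  Theta t ord0 i - Theta s ord0 i = - \int[mu]_(x in `[s, t]) v x ord0 i.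
Proof.
move=> s0 st tT; rewrite (Theta_flow (le_trans s0 st) tT).
rewrite (Theta_flow s0 (le_trans st tT)) !mxE.
rewrite -(RintegralB_itv s0 st); last exact: bmeas_sub (bv i).
by ring.
Qed.

(* The two sides differ by a function of b with increments O((t - s)^2). *)
Lemma chain_rule f g a b : c11 (fun _ => f) (fun _ => g) ->
  0 <= a -> a <= b -> b <= T ->
  f (Theta b) - f (Theta a) = - \int[mu]_(s in `[a, b]) dot (g (Theta s)) (v s).
Proof.
move=> fg a0 ab bT.
have bTheta i : bmeas 0 T (fun s => Theta s ord0 i).
  by apply: (bmeas_comp_curve (h := fun x : V => x ord0 i)) => x;
    exact: coord_continuous.
have bg i : bmeas 0 T (fun s => g (Theta s) ord0 i).
  have cg : continuous (fun x : V => g x ord0 i).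
    by move=> x; apply: (c11_continuous_grad (i := i) fg).
  exact: (bmeas_comp_curve cg).
have bgv : bmeas 0 T (fun s => dot (g (Theta s)) (v s)) by exact: bmeas_dot.
have [M _ ThetaM] := bmeas_norm_bound bTheta.
have [L L0 vL] := bmeas_norm_bound bv.
have [C C0 B] := c11_bounds M fg.
have lip s t : 0 <= s -> s <= t -> t <= T ->
    `|Theta t - Theta s| <= L * (t - s).
  move=> s0 st tT; apply: row_norm_le; first by rewrite mulr_ge0// subr_ge0.
  move=> i; rewrite !mxE flow_increment// normrN.
  apply: normr_Rintegral_le => //; first exact: bmeas_sub (bv i).
  move=> x; rewrite in_itv/= => /andP[sx xt].
  apply: le_trans (ler_coord_norm _ _) _; apply: vL.
  by rewrite in_itv/= (le_trans s0)// (le_trans xt).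
pose F t := f (Theta t) + \int[mu]_(s in `[0, t]) dot (g (Theta s)) (v s).
suff Fcst t : 0 <= t -> t <= T -> F t = F 0.
  have := Fcst b (le_trans a0 ab) bT; rewrite -(Fcst a a0 (le_trans ab bT)).
  rewrite /F -(RintegralB_itv a0 ab); last exact: bmeas_sub bgv.
  have alg (x y u w : R) : x + u = y + w -> x - y = - (u - w) by move=> E; lra.
  exact: alg.
move=> t0 tT.
(* The first summand bounds the Taylor remainder of [f], as [Theta] is L-Lipschitz. The second
   bounds the error of freezing the gradient at time r: it moves by at most C L (s - r) and is
   paired with a velocity of norm at most L. *)
pose K := C * L ^+ 2 + n.+1%:R * (C * L) * L.
apply: (@quadratic_increments_cst _ K) => // r s r0 rs st.
have sT := le_trans st tT; have s0 := le_trans r0 rs.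
have inM x : 0 <= x -> x <= T -> `|Theta x| <= M.
  by move=> x0 xT; apply: ThetaM; rewrite in_itv/= x0.
have bvrs i : bmeas r s (fun x => v x ord0 i) by exact: bmeas_sub (bv i).
have bgvrs : bmeas r s (fun x => dot (g (Theta x)) (v x)) by exact: bmeas_sub bgv.
have bcv : bmeas r s (fun x => dot (g (Theta r)) (v x)).
  by apply: bmeas_dot => // i; exact: bmeas_cst.
(* The linear Taylor term is exactly the integral with frozen gradient. *)
have lin : dot (g (Theta r)) (Theta s - Theta r) =
    - \int[mu]_(x in `[r, s]) dot (g (Theta r)) (v x).
  rewrite /dot Rintegral_sum_bmeas; last first.
    by move=> i; exact: bmeasM (bmeas_cst _ _ _) (bvrs i).
  rewrite -sumrN; apply: eq_bigr => i _.
  by rewrite !mxE flow_increment// RintegralZ_bmeas// mulrN.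
have rT := le_trans rs sT.
have [_ _ _ tay] := B _ _ (inM _ r0 rT) (inM _ s0 sT).
have -> : F s - F r =
    (f (Theta s) - f (Theta r) - dot (g (Theta r)) (Theta s - Theta r)) +
    \int[mu]_(x in `[r, s]) (dot (g (Theta x)) (v x) - dot (g (Theta r)) (v x)).
  rewrite RintegralB_bmeas// lin.
  rewrite -(RintegralB_itv (f := fun x => dot (g (Theta x)) (v x)) r0 rs).
    by rewrite /F; ring.
  exact: bmeas_sub bgv.
apply: le_trans (ler_normD _ _) _; rewrite /K mulrDl; apply: lerD.
  apply: le_trans tay _; rewrite -mulrA -exprMn ler_wpM2l//.
  by rewrite lerXn2r ?nnegrE ?mulr_ge0 ?subr_ge0// lip.
rewrite expr2 [leRHS]mulrA; apply: normr_Rintegral_le => //.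
  have := bmeasD bgvrs (bmeasM (bmeas_cst r s (-1)) bcv).
  by under eq_fun do rewrite mulN1r.
move=> x; rewrite in_itv/= => /andP[rx xs].
have x0 := le_trans r0 rx; have xT := le_trans xs sT.
rewrite -dotBl; apply: le_trans (dot_norm_le _ _) _.
have vx : `|v x| <= L by apply: vL; rewrite in_itv/= x0.
have gx : `|g (Theta x) - g (Theta r)| <= C * L * (s - r).
  have [_ _ gl _] := B _ _ (inM _ r0 rT) (inM _ x0 xT).
  apply: le_trans gl _; rewrite -mulrA ler_wpM2l//.
  by apply: le_trans (lip _ _ r0 rx xT) _; rewrite ler_wpM2l// lerB.
have -> : n.+1%:R * (C * L) * L * (s - r) = n.+1%:R * (C * L * (s - r)) * L by ring.
by rewrite ler_pM ?mulr_ge0// ler_pM2l// ltr0n.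
Qed.

End chain_rule.

End gradient_flows.

(** * The network and its risk *)

Section network.
Context {R : realType} {H : nat}.
Local Notation V := 'rV[R]_(3 * H).+1.
Local Notation mu := (@lebesgue_measure R).
Local Notation coord := Defs.coord.
Implicit Types (phi : V) (r : \bar R) (y s alpha : R).

Definition coord_vec (k : nat) : V := delta_mx ord0 (inord k.-1).

Definition preact phi (j : nat) y : R := coord phi j * y + coord phi (H + j).

(* Formal gradient of [net r phi y] in phi. *)
Definition dnet r phi y : V :=
  coord_vec (3 * H + 1) +
  \sum_(1 <= j < H.+1)
    (coord phi (2 * H + j) *:
       (dsigma r (preact phi j y) *: (y *: coord_vec j + coord_vec (H + j))) +
     sigma r (preact phi j y) *: coord_vec (2 * H + j)).

(** For finite r >= 1 this is the true gradient of the risk; at r = +oo it is the explicit form of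
    the generalized gradient. *)
Definition drisk alpha r phi : V :=
  \row_i \int[mu]_(y in `[0, 1])
    (2 * (net r phi y - alpha) * dnet r phi y ord0 i).

Lemma dot_coord_vec k phi : dot (coord_vec k) phi = coord phi k.
Proof. exact: dot_delta. Qed.

Lemma c11_coord_vec k : c11 (fun _ phi => coord phi k) (fun _ _ => coord_vec k).
Proof. exact: c11_coord. Qed.

Lemma c11_net s : 1 <= s ->
  c11 (fun y phi => net s%:E phi y) (fun y phi => dnet s%:E phi y).
Proof.
move=> s1; apply: c11D; first exact: c11_coord_vec.
apply: c11_sum => j; apply: c11M; first exact: c11_coord_vec.
apply: c11_sigma => //; apply: c11D; last exact: c11_coord_vec.
have cid : c11 (fun y (_ : V) => y) (fun _ _ => 0).
  by apply: (c11_cst (h := id)) => y; exact: cvg_id.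
apply: c11_ext (c11M (c11_coord_vec j) cid) => // y phi.
by rewrite scaler0 add0r.
Qed.

Lemma c11_loss alpha s : 1 <= s ->
  c11 (fun y phi => (net s%:E phi y - alpha) ^+ 2)
      (fun y phi => (2 * (net s%:E phi y - alpha)) *: dnet s%:E phi y).
Proof.
move=> s1; have ca : c11 (fun _ (_ : V) => - alpha) (fun _ _ => 0).
  by apply: (c11_cst (h := fun=> - alpha)) => y; exact: cvg_cst.
have cd := c11D (c11_net s1) ca.
apply: c11_ext (c11M cd cd) => [y phi|y phi]; first by rewrite expr2.
by rewrite addr0 -scalerDl; congr (_ *: _); ring.
Qed.

Lemma c11_risk alpha s : 1 <= s ->
  c11 (fun _ => risk alpha s%:E) (fun _ => drisk alpha s%:E).
Proof.
move=> s1; apply: c11_ext (c11_Rintegral (c11_loss alpha s1)) => // _ phi.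
by apply/rowP => i; rewrite !mxE; apply: eq_Rintegral => y _; rewrite mxE.
Qed.

(** Unlike the constants in [c11_net], this one is uniform in s, as dominated convergence for r to
    infinity demands. *)
Lemma net_dnet_bound (M : R) : 0 <= M ->
  exists2 C, 0 <= C & forall s phi y, 1 <= s -> `|phi| <= M -> y \in `[0, 1]%R ->
  `|net s%:E phi y| <= C /\ `|dnet s%:E phi y| <= C.
Proof.
(* S bounds the contribution of one neuron to [dnet]: M * 2 from the inner parameters, where y times
   one unit vector plus another has norm at most 2, and M + M + 1 from the activation. *)
move=> M0; pose S := M * 2 + (M + M + 1).
have S0 : 0 <= S by rewrite /S; lra.
exists (M + 1 + H%:R * ((M + 1) * S)).
  by rewrite !addr_ge0 ?mulr_ge0// ?addr_ge0.
move=> s phi y s1 phiM; rewrite in_itv/= => /andP[y0 y1].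
have s0 : 0 < s by exact: lt_le_trans s1.
have cM k : `|coord phi k| <= M by apply: le_trans phiM; exact: ler_coord_norm.
have vec1 k : `|coord_vec k| <= 1.
  apply: row_norm_le => // i; rewrite mxE eqxx /=.
  by case: eqP => _; rewrite ?normr0 ?normr1.
have ny : `|y| <= 1 by rewrite ger0_norm.
have preM j : `|preact phi j y| <= M + M.
  apply: le_trans (ler_normD _ _) _; apply: lerD => //.
  by rewrite normrM -[M]mulr1 ler_pM.
have sigM j : `|sigma s%:E (preact phi j y)| <= M + M + 1.
  by apply: le_trans (sigma_norm_le _ s1) _; rewrite lerD2r.
have sum_le (W : normedZmodType R) (F : nat -> W) B :
    (forall j, `|F j| <= B) -> `|\sum_(1 <= j < H.+1) F j| <= H%:R * B.
  move=> FB; apply: le_trans (ler_norm_sum _ _ _) _.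
  apply: (@le_trans _ _ (\sum_(1 <= j < H.+1) B)); first exact: ler_sum.
  by rewrite big_const_nat subSS subn0 iter_addr addr0 mulr_natl.
split; apply: le_trans (ler_normD _ _) _.
  apply: lerD; first by apply: le_trans (cM _) _; rewrite lerDl.
  apply: sum_le => j; rewrite normrM; apply: ler_pM => //.
    by apply: le_trans (cM _) _; rewrite lerDl.
  by apply: le_trans (sigM _) _; rewrite /S; lra.
apply: lerD; first by apply: le_trans (vec1 _) _; rewrite lerDr.
apply: sum_le => j; apply: le_trans (ler_normD _ _) _.
apply: (@le_trans _ _ S); last by rewrite ler_peMl// lerDr.
have scl (a : R) (b : V) (A B : R) : `|a| <= A -> `|b| <= B -> `|a *: b| <= A * B.
  by move=> aA bB; rewrite normrZ ler_pM.
apply: lerD; last by rewrite -[leRHS]mulr1; apply: (scl).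
apply: (scl) => //; rewrite -[leRHS]mul1r; apply: (scl); first exact: dsigma_norm_le1.
apply: le_trans (ler_normD _ _) _; apply: lerD => //.
by rewrite -[leRHS]mul1r; apply: (scl).
Qed.

Lemma loss_dloss_bound alpha (M : R) : 0 <= M ->
  exists2 C, 0 <= C & forall s phi y, 1 <= s -> `|phi| <= M -> y \in `[0, 1]%R ->
  `|(net s%:E phi y - alpha) ^+ 2| <= C /\
  forall i, `|2 * (net s%:E phi y - alpha) * dnet s%:E phi y ord0 i| <= C.
Proof.
move=> /net_dnet_bound[C C0 B]; have a0 := normr_ge0 alpha.
have D0 : 0 <= C + `|alpha| by exact: addr_ge0.
exists (2 * (C + `|alpha|) * (C + `|alpha|)); first by rewrite !mulr_ge0.
move=> s phi y s1 phiM y01; have [nC dC] := B s phi y s1 phiM y01.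
have naD : `|net s%:E phi y - alpha| <= C + `|alpha|.
  by apply: le_trans (ler_normB _ _) _; rewrite lerD2r.
split=> [|i].
  rewrite expr2 normrM -mulrA; apply: (@le_trans _ _ ((C + `|alpha|) * (C + `|alpha|))).
    by rewrite ler_pM.
  by rewrite ler_peMl ?mulr_ge0// ler1n.
rewrite normrM [X in X * _]normrM (ger0_norm (ler0n _ 2)).
apply: ler_pM; rewrite ?mulr_ge0//; first by rewrite ler_pM2l.
apply: le_trans (ler_coord_norm _ _) _; apply: le_trans dC _.
by rewrite lerDl.
Qed.

(** * Passage to the limit r = +oo in the network, the risk and its gradient *)

Lemma cvg_sum_seq (I : Type) (t : seq I) (F : nat -> I -> R) (f : I -> R) :
  (forall j, F n j @[n --> \oo] --> f j) ->
  \sum_(j <- t) F n j @[n --> \oo] --> \sum_(j <- t) f j.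
Proof.
move=> Ff; elim: t => [|j t IH].
  by under eq_fun do rewrite big_nil; rewrite big_nil; exact: cvg_cst.
by under eq_fun do rewrite big_cons; rewrite big_cons; exact: cvgD.
Qed.

Lemma cvg_net phi y : net (n.+1%:R)%:E phi y @[n --> \oo] --> net +oo%E phi y.
Proof.
apply: cvgD; first exact: cvg_cst.
apply: cvg_sum_seq => j; apply: cvgMr; exact: cvg_sigma.
Qed.

Lemma cvg_dnet phi y i :
  dnet (n.+1%:R)%:E phi y ord0 i @[n --> \oo] --> dnet +oo%E phi y ord0 i.
Proof.
have dnetE r : dnet r phi y ord0 i = coord_vec (3 * H + 1) ord0 i +
    \sum_(1 <= j < H.+1)
    (coord phi (2 * H + j) *
       (dsigma r (preact phi j y) * (y *: coord_vec j + coord_vec (H + j)) ord0 i) +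
     sigma r (preact phi j y) * coord_vec (2 * H + j) ord0 i).
  by rewrite mxE summxE; congr (_ + _); apply: eq_bigr => j _; rewrite !mxE.
under eq_fun do rewrite dnetE; rewrite dnetE.
apply: cvgD; first exact: cvg_cst.
apply: cvg_sum_seq => j; apply: cvgD.
  by apply: cvgMr; apply: cvgMl; exact: cvg_dsigma.
by apply: cvgMl; exact: cvg_sigma.
Qed.

Let one_le_succ n : 1 <= n.+1%:R :> R. Proof. by rewrite ler1n. Qed.

Lemma bmeas_loss alpha s phi : 1 <= s ->
  bmeas 0 1 (fun y => (net s%:E phi y - alpha) ^+ 2) /\
  forall i, bmeas 0 1 (fun y => 2 * (net s%:E phi y - alpha) * dnet s%:E phi y ord0 i).
Proof.
move=> s1; have [bl bd] := c11_bmeas phi (c11_loss alpha s1).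
by split=> // i; have := bd i; under eq_fun do rewrite mxE.
Qed.

Lemma cvg_loss alpha phi y :
  (net (n.+1%:R)%:E phi y - alpha) ^+ 2 @[n --> \oo] -->
  (net +oo%E phi y - alpha) ^+ 2.
Proof.
under eq_fun do rewrite expr2; rewrite expr2.
by apply: cvgM; (apply: cvgB; [exact: cvg_net|exact: cvg_cst]).
Qed.

Lemma cvg_dloss alpha phi y i :
  2 * (net (n.+1%:R)%:E phi y - alpha) * dnet (n.+1%:R)%:E phi y ord0 i @[n --> \oo]
  --> 2 * (net +oo%E phi y - alpha) * dnet +oo%E phi y ord0 i.
Proof.
apply: cvgM; last exact: cvg_dnet.
by apply: cvgMr; apply: cvgB; [exact: cvg_net|exact: cvg_cst].
Qed.

Lemma cvg_risk alpha phi :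
  risk alpha (n.+1%:R)%:E phi @[n --> \oo] --> risk alpha +oo%E phi.
Proof.
have [C _ B] := loss_dloss_bound alpha (normr_ge0 phi).
apply: (@Rintegral_bounded_cvg _ _ _ C) => [n|n y y01|y _].
- by have [[]] := bmeas_loss alpha phi (one_le_succ n).
- by have [] := B n.+1%:R phi y (one_le_succ n) (lexx _) y01.
- exact: cvg_loss.
Qed.

Lemma cvg_drisk alpha phi i :
  drisk alpha (n.+1%:R)%:E phi ord0 i @[n --> \oo] --> drisk alpha +oo%E phi ord0 i.
Proof.
have [C _ B] := loss_dloss_bound alpha (normr_ge0 phi).
under eq_fun do rewrite mxE; rewrite mxE.
apply: (@Rintegral_bounded_cvg _ _ _ C) => [n|n y y01|y _].
- by have [_ /(_ i)[]] := bmeas_loss alpha phi (one_le_succ n).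
- by have [_ ] := B n.+1%:R phi y (one_le_succ n) (lexx _) y01.
- exact: cvg_dloss.
Qed.

Lemma bmeas_dloss_oo alpha phi i :
  bmeas 0 1 (fun y => 2 * (net +oo%E phi y - alpha) * dnet +oo%E phi y ord0 i).
Proof.
have [C _ B] := loss_dloss_bound alpha (normr_ge0 phi).
apply: (@bmeas_cvg _ _ _ C (fun n y => 2 * (net (n.+1%:R)%:E phi y - alpha) *
    dnet (n.+1%:R)%:E phi y ord0 i)) => [n|n y y01|y _].
- by have [_ /(_ i)[]] := bmeas_loss alpha phi (one_le_succ n).
- by have [_ ] := B n.+1%:R phi y (one_le_succ n) (lexx _) y01.
- exact: cvg_dloss.
Qed.

Lemma drisk_bound alpha (M : R) : 0 <= M ->
  exists2 C, 0 <= C & forall n phi i, `|phi| <= M ->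
  `|drisk alpha (n.+1%:R)%:E phi ord0 i| <= C.
Proof.
move=> /(loss_dloss_bound alpha)[C C0 B]; exists C => // n phi i phiM; rewrite mxE.
rewrite -[C]mulr1 -[X in C * X](subr0 1); apply: normr_Rintegral_le => //.
  by have [_ ] := bmeas_loss alpha phi (one_le_succ n).
by move=> y y01; have [_ ] := B n.+1%:R phi y (one_le_succ n) phiM y01.
Qed.

(** The smooth gradients converge at every point, so the defining condition determines [G]
    everywhere. *)
Lemma generalized_gradientE alpha (G : V -> V) phi :
  is_generalized_gradient alpha G -> G phi = drisk alpha +oo%E phi.
Proof.
move=> /(_ phi)/=; set u := fun n => _.
have cu : u n @[n --> \oo] --> drisk alpha +oo%E phi.
  rewrite (_ : u = fun n => drisk alpha (n.+1%:R)%:E phi).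
    by apply: cvg_row => i; exact: cvg_drisk.
  by apply/funext => n; exact: c11_gradE (c11_risk alpha (one_le_succ n)).
by move=> ->; [exact: cvg_lim|exact: cvgP cu].
Qed.

(** * The Lyapunov function and its derivative along the field *)

Definition dlyapunov alpha phi : V :=
  2 *: phi + (2 * (coord phi (3 * H + 1) - 2 * alpha)) *: coord_vec (3 * H + 1).

Lemma c11_lyapunov alpha :
  c11 (fun _ : R => @lyapunov R H alpha) (fun _ => dlyapunov alpha).
Proof.
have ca : c11 (fun _ (_ : V) => - (2 * alpha)) (fun _ _ => 0).
  by apply: (c11_cst (h := fun=> - (2 * alpha))) => y; exact: cvg_cst.
have cc := c11D (c11_coord_vec (3 * H + 1)) ca.
have cs := c11_sum (index_enum _)
  (fun i : 'I_(3 * H).+1 => c11M (c11_coord i) (c11_coord (R := R) i)).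
apply: c11_ext (c11D cs (c11M cc cc)) => _ phi.
  by rewrite /lyapunov /enorm sqr_sqrtr// sumr_ge0// => i _; exact: sqr_ge0.
rewrite /dlyapunov addr0 -scalerDl; congr (_ + _ *: _); last by ring.
rewrite [in RHS](row_sum_delta phi) scaler_sumr; apply: eq_bigr => i _.
by rewrite scalerA -scalerDl; congr (_ *: _); ring.
Qed.

Lemma coord_vec_last k : (0 < k <= 3 * H)%N ->
  coord (coord_vec (3 * H + 1)) k = 0.
Proof.
move=> /andP[k0 kH]; rewrite /coord mxE eqxx /= addn1 /=.
case: eqP => // /(congr1 val); rewrite /= !inordK//; first by lia.
by rewrite ltnS; lia.
Qed.

(* The factor 4 is Euler's identity: the hidden layer is homogeneous of degree 2 in
   phi, and the last summand of the Lyapunov function compensates the output bias. *)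
Lemma dot_dlyapunov_dnet alpha phi y :
  dot (dlyapunov alpha phi) (dnet +oo%E phi y) = 4 * (net +oo%E phi y - alpha).
Proof.
rewrite /dlyapunov dotDl !dotZl dot_coord_vec.
(* The output bias does not enter the hidden layer. *)
have -> : coord (dnet +oo%E phi y) (3 * H + 1) = 1.
  rewrite -dot_coord_vec dotC dotDl dot_coord_vec.
  rewrite {1}/coord mxE !eqxx dot_suml big_nat big1 ?addr0// => j /andP[j0 jH].
  rewrite dotDl !dotZl dotDl !dotZl !dot_coord_vec.
  by rewrite !coord_vec_last ?mulr0 ?addr0 ?mulr0//; lia.
(* Each neuron counts twice, once through its outer weight and once through its inner parameters;
   the bias c counts once. The claim is then 2 (2 N - c) + 2 (c - 2 alpha) = 4 (N - alpha). *)
have -> : dot phi (dnet +oo%E phi y) = 2 * net +oo%E phi y - coord phi (3 * H + 1).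
  rewrite dotC dotDl dot_coord_vec dot_suml /net.
  rewrite (eq_bigr (fun j => 2 * (coord phi (2 * H + j) *
    sigma +oo%E (preact phi j y)))); last first.
    move=> j _; rewrite dotDl !dotZl dotDl dotZl !dot_coord_vec.
    rewrite (mulrC y) -/(preact phi j y) dsigma_oo_mul.
    by rewrite [X in _ + X]mulrC -mulr2n mulr_natl.
  by rewrite -mulr_sumr; ring.
by ring.
Qed.

(** The integrand is 2 (N - alpha) times 4 (N - alpha). *)
Lemma dot_dlyapunov_drisk alpha phi :
  dot (dlyapunov alpha phi) (drisk alpha +oo%E phi) = 8 * risk alpha +oo%E phi.
Proof.
rewrite dotC dot_Rintegral; last exact: bmeas_dloss_oo.
rewrite /risk -RintegralZ_bmeas; last first.
  have [C _ B] := loss_dloss_bound alpha (normr_ge0 phi).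
  apply: (@bmeas_cvg _ _ _ C (fun n y => (net (n.+1%:R)%:E phi y - alpha) ^+ 2))
    => [n|n y y01|y _].
  - by have [[]] := bmeas_loss alpha phi (one_le_succ n).
  - by have [] := B n.+1%:R phi y (one_le_succ n) (lexx _) y01.
  - exact: cvg_loss.
apply: eq_Rintegral => y _.
have -> : \row_i (2 * (net +oo%E phi y - alpha) * dnet +oo%E phi y ord0 i) =
    (2 * (net +oo%E phi y - alpha)) *: dnet +oo%E phi y.
  by apply/rowP => i; rewrite !mxE.
by rewrite dotZl dotC dot_dlyapunov_dnet; ring.
Qed.

End network.

(** * The gradient flow *)

Section flow.
Context {R : realType} {H : nat}.
Local Notation V := 'rV[R]_(3 * H).+1.
Local Notation mu := (@lebesgue_measure R).
Variables (alpha : R) (G : V -> V) (Theta : R -> V).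
Hypothesis G_grad : is_generalized_gradient alpha G.
Hypothesis Theta_cont : {within `[0, +oo[, continuous Theta}.
Hypothesis Theta_flow : forall t : R, 0 <= t ->
  Theta t = Theta 0 - row_integral 0 t (fun s => G (Theta s)).

Let one_le_succ n : 1 <= n.+1%:R :> R. Proof. by rewrite ler1n. Qed.

Let Theta_cont_itv T : {within `[0, T], continuous Theta}.
Proof.
apply: continuous_subspaceW Theta_cont => x /=.
by rewrite !in_itv/= => /andP[->].
Qed.

Let bmeas_coord_Theta T i : bmeas 0 T (fun s => Theta s ord0 i).
Proof.
have cx : continuous (fun x : V => x ord0 i) by move=> x; exact: coord_continuous.
exact: (bmeas_comp_curve (@Theta_cont_itv T) cx).
Qed.

Let bmeas_drisk n T i :
  bmeas 0 T (fun s => drisk alpha (n.+1%:R)%:E (Theta s) ord0 i).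
Proof.
have cg : continuous (fun x : V => drisk alpha (n.+1%:R)%:E x ord0 i).
  by move=> x; apply: (c11_continuous_grad (i := i) (c11_risk alpha (one_le_succ n))).
exact: (bmeas_comp_curve (@Theta_cont_itv T) cg).
Qed.

Let drisk_bounded T : exists2 C, 0 <= C & forall n s i, s \in `[0, T]%R ->
  `|drisk alpha (n.+1%:R)%:E (Theta s) ord0 i| <= C.
Proof.
have [M M0 ThetaM] := bmeas_norm_bound (@bmeas_coord_Theta T).
have [C C0 B] := drisk_bound (H := H) alpha M0.
by exists C => // n s i sT; apply: B; exact: ThetaM.
Qed.

(** The limit field need not be continuous in phi, so its values along the curve are treated as
    bounded limits of the smooth gradients. *)
Let bmeas_drisk_oo T i : bmeas 0 T (fun s => drisk alpha +oo%E (Theta s) ord0 i).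
Proof.
have [C _ B] := drisk_bounded T.
apply: (@bmeas_cvg _ _ _ C
  (fun n s => drisk alpha (n.+1%:R)%:E (Theta s) ord0 i)) => [n|n s sT|s _].
- by have [] := bmeas_drisk n T i.
- exact: B.
- exact: cvg_drisk.
Qed.

Let drisk_flow t : 0 <= t ->
  Theta t = Theta 0 - row_integral 0 t (fun s => drisk alpha +oo%E (Theta s)).
Proof.
move=> /Theta_flow; under eq_fun do rewrite (generalized_gradientE _ G_grad).
by [].
Qed.

Lemma flow_chain_rule (f : V -> R) (g : V -> V) a b :
  c11 (fun _ => f) (fun _ => g) -> 0 <= a -> a <= b ->
  f (Theta b) - f (Theta a) =
  - \int[mu]_(s in `[a, b]) dot (g (Theta s)) (drisk alpha +oo%E (Theta s)).
Proof.
move=> fg a0 ab; apply: (chain_rule (@Theta_cont_itv b) (bmeas_drisk_oo b)) => //.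
by move=> t t0 _; exact: drisk_flow.
Qed.

(** By [dot_dlyapunov_drisk] the risk is one eighth of a product of fields already known to be
    measurable along the curve. *)
Lemma bmeas_risk_oo T : bmeas 0 T (fun s => risk alpha +oo%E (Theta s)).
Proof.
have bd i : bmeas 0 T (fun s => dlyapunov alpha (Theta s) ord0 i).
  have cg : continuous (fun x : V => dlyapunov alpha x ord0 i).
    by move=> x; apply: (c11_continuous_grad (i := i) (c11_lyapunov alpha)).
  exact: (bmeas_comp_curve (@Theta_cont_itv T) cg).
have := bmeasM (bmeas_cst 0 T 8^-1) (bmeas_dot bd (bmeas_drisk_oo T)).
by under eq_fun do rewrite dot_dlyapunov_drisk mulKf//.
Qed.

Lemma lyapunov_flow t : 0 <= t ->
  lyapunov alpha (Theta t) = lyapunov alpha (Theta 0) -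
  8 * \int[mu]_(s in `[0, t]) risk alpha +oo%E (Theta s).
Proof.
move=> t0; have := flow_chain_rule (c11_lyapunov alpha) (lexx 0) t0.
under eq_Rintegral do rewrite dot_dlyapunov_drisk.
rewrite RintegralZ_bmeas; last exact: bmeas_risk_oo.
by move=> /eqP; rewrite subr_eq addrC => /eqP.
Qed.

(* The risk itself need not be differentiable along the flow: the energy identity
   is obtained for the smooth risks and passed to the limit. *)
Lemma risk_nonincreasing a b : 0 <= a -> a <= b ->
  risk alpha +oo%E (Theta b) <= risk alpha +oo%E (Theta a).
Proof.
move=> a0 ab; rewrite -subr_le0.
pose D r s := drisk alpha r (Theta s).
have [C C0 B] := drisk_bounded b.
have sub s : s \in `[a, b]%R -> s \in `[0, b]%R.
  by rewrite !in_itv/= => /andP[as_ ->]; rewrite (le_trans a0).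
have cvg_coord s i : D (n.+1%:R)%:E s ord0 i @[n --> \oo] --> D +oo%E s ord0 i.
  exact: cvg_drisk.
have Doo s i : s \in `[0, b]%R -> `|D +oo%E s ord0 i| <= C.
  move=> sb; have cD : `|D (n.+1%:R)%:E s ord0 i| @[n --> \oo] --> `|D +oo%E s ord0 i|.
    by apply: cvg_norm; exact: cvg_coord.
  rewrite -(cvg_lim _ cD)//; apply: limr_le; first exact: cvgP cD.
  by apply: nearW => n; exact: B.
have lhs : risk alpha (n.+1%:R)%:E (Theta b) - risk alpha (n.+1%:R)%:E (Theta a)
    @[n --> \oo] --> risk alpha +oo%E (Theta b) - risk alpha +oo%E (Theta a).
  by apply: cvgB; exact: cvg_risk.
(* The curve moves along the limit field, so the smooth gradient is paired with [D +oo]; only in the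
   limit does the product become a square, whose sign gives the claim. *)
have rhs : - (\int[mu]_(s in `[a, b]) dot (D (n.+1%:R)%:E s) (D +oo%E s))
    @[n --> \oo] --> - \int[mu]_(s in `[a, b]) dot (D +oo%E s) (D +oo%E s).
  apply: cvgN; apply: (@Rintegral_bounded_cvg _ _ _ (\sum_(i < (3 * H).+1) C * C)).
  - move=> n; have [] // : bmeas a b (fun s => dot (D (n.+1%:R)%:E s) (D +oo%E s)).
    apply: (@bmeas_sub _ 0 b) => //.
    by apply: bmeas_dot => i; [exact: bmeas_drisk|exact: bmeas_drisk_oo].
  - move=> n s sab; apply: le_trans (ler_norm_sum _ _ _) _; apply: ler_sum => i _.
    by rewrite normrM; apply: ler_pM => //; [exact/B/sub|exact/Doo/sub].
  - move=> s _; apply: cvg_sum_seq => i.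
    by apply: cvgMl; exact: cvg_coord.
rewrite (_ : _ - _ = - \int[mu]_(s in `[a, b]) dot (D +oo%E s) (D +oo%E s)).
  rewrite oppr_le0; apply: Rintegral_ge0 => s _.
  by apply: sumr_ge0 => i _; rewrite -expr2 sqr_ge0.
have energy : (fun n => risk alpha (n.+1%:R)%:E (Theta b) -
      risk alpha (n.+1%:R)%:E (Theta a)) =
    (fun n => - (\int[mu]_(s in `[a, b]) dot (D (n.+1%:R)%:E s) (D +oo%E s))).
  by apply/funext => n; apply: flow_chain_rule => //; exact: c11_risk.
by move: lhs; rewrite energy => lhs; exact: cvg_unique lhs rhs.
Qed.

Lemma risk_ge0 r (phi : V) : 0 <= risk alpha r phi.
Proof. by apply: Rintegral_ge0 => y _; exact: sqr_ge0. Qed.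

Lemma lyapunov_ge0 (phi : V) : 0 <= lyapunov alpha phi.
Proof. by rewrite addr_ge0// sqr_ge0. Qed.

(** By monotonicity t times the final risk is at most the integral of the risk over [0, t], and 8
    times that integral is at most the initial Lyapunov value because the final one is
    nonnegative. *)
Lemma risk_decay t : 0 < t ->
  risk alpha +oo%E (Theta t) <= lyapunov alpha (Theta 0) / (8 * t).
Proof.
move=> t0; rewrite ler_pdivlMr ?mulr_gt0// mulrCA.
have t0' := ltW t0; have := lyapunov_ge0 (Theta t); rewrite lyapunov_flow// subr_ge0.
apply: le_trans; rewrite ler_pM2l//.
have := Rintegral_cst_itv (risk alpha +oo%E (Theta t)) t0'.
rewrite subr0 => <-; apply: ler_Rintegral_bmeas; [exact: bmeas_cst|exact: bmeas_risk_oo|].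
by move=> s; rewrite in_itv/= => /andP[s0 st]; exact: risk_nonincreasing.
Qed.

(** The squared norm is at most the Lyapunov function, which does not exceed its initial value along
    the flow. *)
Lemma enorm_flow_le t : 0 <= t ->
  enorm (Theta t) <= Num.sqrt (lyapunov alpha (Theta 0)).
Proof.
move=> t0; rewrite -[leLHS]ger0_norm ?sqrtr_ge0// -sqrtr_sqr.
apply: ler_wsqrtr; apply: (@le_trans _ _ (lyapunov alpha (Theta t))).
  by rewrite lerDl sqr_ge0.
rewrite lyapunov_flow// gerBl mulr_ge0//.
by apply: Rintegral_ge0 => s _; exact: risk_ge0.
Qed.

End flow.

Unset Implicit Arguments.

Theorem theorem3p7 (R : realType) (H : nat) (H_gt0 : (0 < H)%N) (alpha : R)
    (G : 'rV[R]_(3 * H).+1 -> 'rV[R]_(3 * H).+1)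
    (G_grad : is_generalized_gradient alpha G)
    (Theta : R -> 'rV[R]_(3 * H).+1)
    (Theta_cont : {within `[0, +oo[, continuous Theta})
    (Theta_flow : forall t : R, 0 <= t ->
      Theta t = Theta 0 - row_integral 0 t (fun s => G (Theta s))) :
  [/\ (ereal_sup [set (enorm (Theta t))%:E | t in `[0%R, +oo[]
         <= (Num.sqrt (lyapunov alpha (Theta 0)))%:E < +oo)%E,
      forall t : R, 0 < t ->
        risk alpha +oo%E (Theta t) <= lyapunov alpha (Theta 0) / (8 * t) &
      limf_esup (fun t : R => (risk alpha +oo%E (Theta t))%:E)
        (pinfty_nbhs R) = 0%E].
Proof.
have decay := risk_decay G_grad Theta_cont Theta_flow.
split=> //.
  rewrite ltry andbT; apply: ge_ereal_sup => _ [t /= + <-].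
  rewrite in_itv/= andbT => t0.
  by rewrite lee_fin (enorm_flow_le G_grad Theta_cont Theta_flow).
apply/eqP; rewrite eq_le; apply/andP; split; last first.
  apply: limf_esup_ge0; first exact: filter_not_empty.
  by move=> t; rewrite lee_fin risk_ge0.
apply/lee_addgt0Pr => e e0; rewrite add0e limf_esupE.
set L := lyapunov alpha (Theta 0) in decay *.
have L0 : 0 <= L by exact: lyapunov_ge0.
(* The limit superior is at most the supremum over the tail t > L / (8 e), where the decay bound L /
   (8 t) lies below e. *)
apply: (@le_trans _ _ (ereal_sup
  [set (risk alpha +oo%E (Theta t))%:E | t in [set t : R | L / (8 * e) < t]])).
  apply: ereal_inf_lbound; exists [set t : R | L / (8 * e) < t] => //.
  by apply: nbhs_pinfty_gt; exact: num_real.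
apply: ge_ereal_sup => _ [t /= tL <-]; rewrite lee_fin.
have t0 : 0 < t by apply: le_lt_trans tL; rewrite divr_ge0// mulr_ge0// ltW.
apply: le_trans (decay _ t0) _.
rewrite ler_pdivrMr ?mulr_gt0//.
by move: tL; rewrite ltr_pdivrMr ?mulr_gt0// => /ltW; rewrite mulrCA [e * _]mulrCA (mulrC e).
Qed.
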